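(* Let $H$ be a separable infinite-dimensional complex Hilbert space, let $J$ be a two-sided ideal of $B(H)$, and let $\mathcal I$ be a (linear) $J$-ideal. A linear functional $\tau : \mathcal I \to \mathbb C$ is a subideal-trace if and only if $\tau$ vanishes on the $\mathcal U_J(H)$-commutator space $[\mathcal I, \mathcal U_J(H)]$ of $\mathcal I$.
   Context: $B(H)$ denotes the algebra of all bounded linear operators on $H$, $\mathcal U(H)$ the group of all unitary operators in $B(H)$, and $\mathbf 1$ the identity operator. No closedness of ideals is assumed. For a two-sided ideal $J$ of $B(H)$ (an arbitrary $B(H)$-ideal, possibly $B(H)$ itself), a $J$-ideal (also called a subideal) is a two-sided ideal $\mathcal I$ of the ring $J$: an additive subgroup $\mathcal I \subseteq J$ such that $AX \in \mathcal I$ and $XA \in \mathcal I$ for all $X \in \mathcal I$, $A \in J$. Throughout, all $J$-ideals are taken to be linear, i.e., $\mathcal I$ is also a complex linear subspace. A $J$-ideal need not be an ideal of $B(H)$. $\mathcal U_J(H) := \{\mathbf 1 + A \in \mathcal U(H) \mid A \in J\}$, a subgroup of $\mathcal U(H)$. If $U \in \mathcal U_J(H)$ and $X \in \mathcal I$, then $UXU^* \in \mathcal I$. A linear functional $\tau : \mathcal I \to \mathbb C$ is called a subideal-trace if $\tau(UXU^* ) = \tau(X)$ for every $X \in \mathcal I$ and every $U \in \mathcal U_J(H)$. The $\mathcal U_J(H)$-commutator space of $\mathcal I$ is $[\mathcal I, \mathcal U_J(H)] := \text{linear span}\{[X,U] \mid X \in \mathcal I,\ U \in \mathcal U_J(H)\}$,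 where $[X,U] := XU - UX$; it is contained in $\mathcal I$. *)

(* Defs.v *)
From HB Require Import structures.
From mathcomp Require Import all_boot all_order all_algebra.
From mathcomp Require Import complex.
From mathcomp Require Import all_classical all_reals.
From mathcomp Require Import topology normedtype.

Set Implicit Arguments.
Unset Strict Implicit.
Unset Printing Implicit Defensive.
Import Order.TTheory GRing.Theory Num.Theory.
Import numFieldNormedType.Exports.

Local Open Scope classical_set_scope.
Local Open Scope ring_scope.

(* [hdot] is linear in its first argument and conjugate-linear in its second
   one. *)
HB.mixin Record isHilbert (K : numClosedFieldType) H
    & CompleteNormedModule K H := {
  hdot : {dot H for Num.conj} ;
  hdot_norm : forall x : H, hdot x x = `|x| ^+ 2
}.

#[short(type="hilbertType")]
HB.structure Definition Hilbert (K : numClosedFieldType) :=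
  {H of CompleteNormedModule K H & isHilbert K H}.

Definition linear_span (K : numFieldType) (V : lmodType K) (S : set V) : set V :=
  [set x | exists n (c : 'I_n -> K) (v : 'I_n -> V),
     (forall i, S (v i)) /\ x = \sum_(i < n) c i *: v i].

Definition infinite_dimensional (K : numFieldType) (V : lmodType K) :=
  forall F : set V, finite_set F -> linear_span F <> [set: V].

Definition separable_space (T : topologicalType) :=
  exists2 D : set T, countable D & dense D.

(* A linear subspace, seen as a vector space of its own. *)
Section LinearSubspace.
Variables (K : numFieldType) (V : lmodType K) (I : submodClosed V).

Record linear_subspace :=
  LinearSubspace { linear_subspace_val :> V; _ : linear_subspace_val \in I }.

HB.instance Definition _ := [isSub for linear_subspace_val].
HB.instance Definition _ := [Choice of linear_subspace by <:].
HB.instance Definition _ := [SubChoice_isSubLmodule of linear_subspace by <:].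

End LinearSubspace.

Section BoundedOperators.
Variables (K : numFieldType) (H : normedModType K).

Definition bounded_operator : {pred H -> H} :=
  fun f => `[< linear f /\ exists M : K, forall x, `|f x| <= M * `|x| >].

Lemma bounded_operatorP f :
  reflect (linear f /\ exists M : K, forall x, `|f x| <= M * `|x|)
          (f \in bounded_operator).
Proof. exact: asboolP. Qed.

Lemma bounded_operator_submod : submod_closed bounded_operator.
Proof.
split=> [|a f g].
  apply/bounded_operatorP; split=> [b x y|]; first by rewrite scaler0 addr0.
  by exists 0 => x; rewrite mul0r normr0.
move=> /bounded_operatorP[fL [M fM]] /bounded_operatorP[gL [N gN]].
apply/bounded_operatorP; split=> [b x y|].
  rewrite /= !fctE fL gL !scalerDr !scalerA (mulrC b) !addrA.
  by congr (_ + _); rewrite -!addrA; congr (_ + _); rewrite addrC.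
exists (`|a| * M + N) => x; rewrite fctE (le_trans (ler_normD _ _))//.
by rewrite mulrDl lerD// normrZ -mulrA ler_wpM2l.
Qed.

HB.instance Definition _ :=
  GRing.isSubmodClosed.Build K (H -> H) bounded_operator bounded_operator_submod.

Record BH := BoundedOp { BH_fun :> H -> H; _ : BH_fun \in bounded_operator }.

HB.instance Definition _ := [isSub for BH_fun].
HB.instance Definition _ := [Choice of BH by <:].
HB.instance Definition _ := [SubChoice_isSubLmodule of BH by <:].

Lemma BH_ext (A B : BH) : A =1 B -> A = B.
Proof. by move=> AB; apply: val_inj; apply/funext. Qed.

Lemma BH_linear (A : BH) : linear A.
Proof. by have /bounded_operatorP[] := valP A. Qed.

Lemma bounded_operator_id : idfun \in bounded_operator.
Proof. by apply/bounded_operatorP; split=> //; exists 1 => x; rewrite mul1r. Qed.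

Lemma bounded_operator_comp (A B : BH) : A \o B \in bounded_operator.
Proof.
have /bounded_operatorP[AL [M AM]] := valP A.
have /bounded_operatorP[BL [N BN]] := valP B.
apply/bounded_operatorP; split=> [a x y|]; first by rewrite /= BL AL.
have M0 x : `|M| * `|x| >= 0 by rewrite mulr_ge0.
have AM' x : `|A x| <= `|M| * `|x|.
  have := AM x; have [->|x0] := eqVneq x 0.
    by rewrite normr0 !mulr0.
  move=> h; have : 0 <= M * `|x| by rewrite (le_trans _ h).
  by rewrite pmulr_lge0 ?normr_gt0// => /ger0_norm ->.
exists (`|M| * N) => x; rewrite -mulrA (le_trans (AM' _))//.
by rewrite ler_wpM2l.
Qed.

Definition BH_one := BoundedOp bounded_operator_id.
Definition BH_comp (A B : BH) := BoundedOp (bounded_operator_comp A B).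

Let compA : associative BH_comp. Proof. by move=> A B C; apply: BH_ext. Qed.
Let comp1l : left_id BH_one BH_comp. Proof. by move=> A; apply: BH_ext. Qed.
Let comp1r : right_id BH_one BH_comp. Proof. by move=> A; apply: BH_ext. Qed.
Let compDl : left_distributive BH_comp +%R.
Proof. by move=> A B C; apply: BH_ext. Qed.
Let compDr : right_distributive BH_comp +%R.
Proof.
move=> A B C; apply: BH_ext => x /=.
by have := BH_linear A 1 (B x) (C x); rewrite !scale1r.
Qed.

HB.instance Definition _ :=
  GRing.Zmodule_isPzRing.Build BH compA comp1l comp1r compDl compDr.

End BoundedOperators.
Arguments BH {K} H.

Section Adjoint.
Variables (K : numClosedFieldType) (H : hilbertType K).
Implicit Types A B U : BH H.

Definition is_adjoint A B := forall x y : H, hdot (A x) y = hdot x (B y).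

Lemma is_adjoint_unique A B B' : is_adjoint A B -> is_adjoint A B' -> B = B'.
Proof.
move=> AB AB'; apply: BH_ext => y; apply/eqP; rewrite -subr_eq0 -normr_eq0.
rewrite -sqrf_eq0 -hdot_norm; set z : H := _ - _.
have -> : hdot z z = hdot z (B y) - hdot z (B' y) by rewrite [in LHS]linearBr.
by rewrite -AB -AB' subrr.
Qed.

(* By the Riesz representation theorem, the adjoint always exists, so that the
   default value 0 is never used. *)
Definition adjoint A : BH H := xget 0 [set B | is_adjoint A B].

Lemma adjoint_eq A B : is_adjoint A B -> adjoint A = B.
Proof.
move=> AB; apply: is_adjoint_unique (AB).
by apply: (@xgetPex _ 0 [set C | is_adjoint A C]); exists B.
Qed.

Definition unitary U := U * adjoint U = 1 /\ adjoint U * U = 1.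

Lemma unitaryP U :
  unitary U <-> exists V, [/\ is_adjoint U V, U * V = 1 & V * U = 1].
Proof.
split=> [[UV VU]|[V [/adjoint_eq UV]]]; last by rewrite /unitary UV.
exists (adjoint U); split=> //.
have [[B UB]|nU] := pselect (exists B, is_adjoint U B).
  by rewrite (adjoint_eq UB).
have H0 (z : H) : z = 0.
  have V0 : adjoint U = 0 by rewrite /adjoint xgetPN// => B UB; apply: nU; exists B.
  by have := congr1 (fun A : BH H => A z) VU; rewrite V0 mul0r.
by move=> x y; rewrite [U x]H0 [x]H0 linear0l linear0l.
Qed.

(* J is an additive subgroup of B(H) by its type. *)
Definition two_sided_ideal (J : zmodClosed (BH H)) :=
  forall A X, X \in J -> A * X \in J /\ X * A \in J.

(* I is a complex linear subspace of B(H) by its type. *)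
Definition subideal (J : zmodClosed (BH H)) (I : submodClosed (BH H)) :=
  {subset I <= J} /\
  forall A X, A \in J -> X \in I -> A * X \in I /\ X * A \in I.

Definition unitary_of (J : zmodClosed (BH H)) : set (BH H) :=
  [set U | unitary U /\ exists2 A, A \in J & U = 1 + A].

Section SubidealTrace.
Variables (J : zmodClosed (BH H)) (I : submodClosed (BH H)).

(* For a J-ideal I, an element Y as below always exists, see [subideal_conj]. *)
Definition subideal_trace (tau : {scalar linear_subspace I}) :=
  forall (U : BH H) (X Y : linear_subspace I), unitary_of J U ->
    val Y = U * val X * adjoint U -> tau Y = tau X.

Definition commutator_space : set (BH H) :=
  linear_span [set C | exists X U, [/\ X \in I, unitary_of J U &
                                      C = X * U - U * X]].

Hypotheses (idJ : two_sided_ideal J) (idI : subideal J I).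

Lemma unitary_of_mul U X : unitary_of J U -> X \in I ->
  [/\ U * X \in I, X * U \in I, adjoint U * X \in I & X * adjoint U \in I].
Proof.
move=> [[UV VU] [A AJ UE]] XI; set V := adjoint U in UV VU *.
have BJ : V - 1 \in J.
  have -> : V - 1 = - (V * A).
    by rewrite -[X in _ - X]VU UE mulrDr mulr1 opprD addrA subrr add0r.
  by rewrite rpredN; case: (idJ V AJ).
have [AX XA] := idI.2 _ _ AJ XI; have [BX XB] := idI.2 _ _ BJ XI.
split.
- by rewrite UE mulrDl mul1r rpredD.
- by rewrite UE mulrDr mulr1 rpredD.
- by rewrite -[V](subrK 1) mulrDl mul1r rpredD.
- by rewrite -[V](subrK 1) mulrDr mulr1 rpredD.
Qed.

Lemma subideal_conj U X : unitary_of J U -> X \in I -> U * X * adjoint U \in I.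
Proof.
by move=> UJ XI; case: (unitary_of_mul UJ XI) => /(unitary_of_mul UJ)[].
Qed.

Lemma commutator_space_sub C : commutator_space C -> C \in I.
Proof.
move=> [n [c [v [vP ->]]]]; apply: rpred_sum => i _; apply: rpredZ.
have [X [U [XI UJ ->]]] := vP i.
by case: (unitary_of_mul UJ XI) => UX XU _ _; rewrite -scaleN1r rpredD// rpredZ.
Qed.

End SubidealTrace.

End Adjoint.

(* Main.v *)
Require Import Defs.
From mathcomp Require Import all_boot all_order all_algebra.
From mathcomp Require Import complex.
From mathcomp Require Import all_classical all_reals.
From mathcomp Require Import topology normedtype.

Import GRing.Theory.

Local Open Scope classical_set_scope.
Local Open Scope ring_scope.

(** Let [U] be a unitary in [1 + J].  Since [U] and its adjoint multiply the
    [J]-ideal [I] into itself on either side, the maps [X |-> X * U] and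
    [Z |-> Z * adjoint U] are mutually inverse on [I].  Under this change of
    variable the commutators are exactly the defects of unitary invariance:
    with [Z := X * U], the conjugate [U * Z * adjoint U] is [U * X], so that
    [X * U - U * X = Z - U * Z * adjoint U] ([commutator_conj]).  Hence [tau] is
    invariant under conjugation iff it kills every commutator, and by linearity
    it then kills their span ([scalar_linear_span0]). *)

(** The elements of [S] have to be lifted to [I] before [tau] can be applied to
    them, hence the inclusion of [S] in [I]. *)
Lemma scalar_linear_span0 (K : numFieldType) (V : lmodType K)
    (I : submodClosed V) (S : set V) (tau : {scalar linear_subspace I}) :
  (forall v, S v -> v \in I) ->
  (forall X : linear_subspace I, S (val X) -> tau X = 0) ->
  forall X : linear_subspace I, linear_span S (val X) -> tau X = 0.
Proof.
move=> SI tauS X [n [c [v [Sv XE]]]].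
pose w i : linear_subspace I := LinearSubspace (SI _ (Sv i)).
have -> : X = \sum_(i < n) c i *: w i.
  apply: val_inj; rewrite XE raddf_sum.
  by apply: eq_bigr.
rewrite linear_sum big1// => i _.
by rewrite scalarZ tauS ?mulr0//; apply: Sv.
Qed.

Lemma commutator_conj (K : numClosedFieldType) (H : hilbertType K)
    (U X : BH H) : unitary U ->
  X * U - U * X = X * U - U * (X * U) * adjoint U.
Proof. by move=> [UV _]; rewrite -!mulrA UV mulr1. Qed.

Theorem proposition5p7 (R : realType) (H : hilbertType R[i])
  (H_separable : separable_space H) (H_infinite : infinite_dimensional H)
  (J : zmodClosed (BH H)) (J_ideal : two_sided_ideal J)
  (I : submodClosed (BH H)) (I_subideal : subideal J I)
  (tau : {scalar linear_subspace I}) :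
  subideal_trace J tau <->
  (forall X : linear_subspace I, commutator_space J I (val X) -> tau X = 0).
Proof.
split=> [tau_tr|tau0 U X Y UJ YE].
  apply: scalar_linear_span0 => [C [X [U [XI UJ ->]]]|C [X [U [XI UJ CE]]]].
    have [UX XU _ _] := unitary_of_mul J_ideal I_subideal UJ XI.
    by rewrite -scaleN1r rpredD// rpredZ.
  have [_ XU _ _] := unitary_of_mul J_ideal I_subideal UJ XI.
  pose Z : linear_subspace I := LinearSubspace XU.
  pose Y : linear_subspace I :=
    LinearSubspace (subideal_conj J_ideal I_subideal UJ XU).
  have -> : C = Z - Y.
    by apply: val_inj; rewrite CE (commutator_conj _ _ _ _ UJ.1).
  by rewrite linearB (tau_tr U Z Y UJ erefl) subrr.
have [_ _ _ XV] := unitary_of_mul J_ideal I_subideal UJ (valP X).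
have VU : adjoint U * U = 1 := UJ.1.2.
suff : tau (X - Y) = 0 by rewrite linearB => /subr0_eq ->.
apply: tau0; exists 1%N, (fun=> 1), (fun=> val (X - Y)); split=> [_|].
  exists (val X * adjoint U), U; split=> //.
  by rewrite (commutator_conj _ _ _ _ UJ.1) -[_ * _ * U]mulrA VU mulr1 -YE.
by rewrite big_ord1 scale1r.
Qed.
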